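(* Let $F_{\mathrm{Select}}:\mathbb{R}^d\to\{0,1\}$, $F_{\mathrm{Certify}}:\mathbb{R}^d\to\{1,\dots,m\}$ and $F_{\mathrm{Core}}:\mathbb{R}^d\to\{1,\dots,m\}$ be classifiers with $m\ge 2$, let $\sigma_\epsilon>0$, $\alpha\in(0,1)$, let $n\ge 1$ be an integer, and let $F_{\mathrm{ACES}}$ be the compositional classifier built from them (defined in the context). Fix $x\in\mathbb{R}^d$ and let $\hat c$ be the (random) class returned by the algorithm $\textsc{Predict}(\sigma_\epsilon,x,n,\alpha)$ described in the context. Then, with confidence at least $1-\alpha$, if $\hat c\neq\oslash$ then $\hat c=F_{\mathrm{ACES}}(x)$. That is, over the randomness of the sampling in the algorithm, $$\mathbb{P}\big(\hat c=\oslash\ \text{ or }\ \hat c=F_{\mathrm{ACES}}(x)\big)\ \ge\ 1-\alpha .$$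
   Context: All classifiers are measurable functions. For a classifier $F$ on $\mathbb{R}^d$ with values in a finite label set, its smoothed version is $\bar F(x):=\arg\max_c \mathbb{P}_{\epsilon\sim\mathcal N(0,\sigma_\epsilon^2 I)}(F(x+\epsilon)=c)$, where $c$ ranges over the label set and ties are broken by some fixed rule. The labels are $\{0,1\}$ for $F_{\mathrm{Select}}$ and $\{1,\dots,m\}$ for $F_{\mathrm{Certify}}$. The ACES classifier is $$F_{\mathrm{ACES}}(x)=\bar F_{\mathrm{Select}}(x)\cdot \bar F_{\mathrm{Certify}}(x)+(1-\bar F_{\mathrm{Select}}(x))\cdot F_{\mathrm{Core}}(x),$$ with the smoothed classifiers evaluated exactly. $F_{\mathrm{Core}}$ is evaluated deterministically, without smoothing. The symbol $\oslash$ denotes abstention. Subroutines: - $\textsc{SampleWNoise}(F,x,N,\sigma_\epsilon)$ draws $N$ i.i.d. samples $\epsilon_i\sim\mathcal N(0,\sigma_\epsilon^2 I)$ and returns the array of counts of how often $F$ predicts each label on $x+\epsilon_1,\dots,x+\epsilon_N$. Separate calls use independent samples. - $\textsc{BinomPValue}(k,N,p)$ returns the probability of at least $k$ successes in $N$ independent Bernoulli trials with success probability $p$. Algorithm $\textsc{Predict}(\sigma_\epsilon,x,n,\alpha)$: 1. $\mathrm{counts}_S\leftarrow\textsc{SampleWNoise}(F_{\mathrm{Select}},x,n,\sigma_\epsilon)$ and $\mathrm{counts}_C\leftarrow\textsc{SampleWNoise}(F_{\mathrm{Certify}},x,n,\sigma_\epsilon)$. 2. $n_0\leftarrow\mathrm{counts}_S[0]$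 and $n_1\leftarrow\mathrm{counts}_S[1]$. 3. $\hat c_A,\hat c_B\leftarrow$ the indices of the largest and second largest entries of $\mathrm{counts}_C$; $n_A\leftarrow\mathrm{counts}_C[\hat c_A]$ and $n_B\leftarrow\mathrm{counts}_C[\hat c_B]$. 4. $\rho_A\leftarrow\textsc{BinomPValue}(n_A,n_A+n_B,\tfrac12)$. 5. If $n_1>n_0$ and $\textsc{BinomPValue}(n_1,n,\tfrac12)\le\tfrac{\alpha}{2}$ and $\rho_A\le\tfrac{\alpha}{2}$: return $\hat c_A$. Else if $n_0>n_1$ and $\textsc{BinomPValue}(n_0,n,\tfrac12)\le\tfrac{\alpha}{2}$: return $F_{\mathrm{Core}}(x)$. Else if $\hat c_A=F_{\mathrm{Core}}(x)$ and $\rho_A\le\tfrac{\alpha}{2}$: return $\hat c_A$. Else: return $\oslash$. *)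

(* Defs.v *)
From HB Require Import structures.
From mathcomp Require Import all_boot all_order all_algebra.
From mathcomp Require Import all_classical all_reals all_analysis.

Set Implicit Arguments.
Unset Strict Implicit.
Unset Printing Implicit Defensive.

Import Order.TTheory GRing.Theory Num.Theory.

Local Open Scope classical_set_scope.
Local Open Scope ring_scope.

Section product_of_probabilities.
Context d1 d2 (T1 : measurableType d1) (T2 : measurableType d2) (R : realType).
Variables (P1 : probability T1 R) (P2 : probability T2 R).

Definition prod_prob := (P1 \x P2)%E.

HB.instance Definition _ := Measure.on prod_prob.

Let prod_prob_setT : prod_prob setT = 1%E.
Proof.
rewrite /prod_prob -setXTT product_measure1E//.
by rewrite -[RHS]mule1; congr (_ * _)%E; exact: probability_setT.
Qed.

HB.instance Definition _ :=
  Measure_isProbability.Build _ _ _ prod_prob prod_prob_setT.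
End product_of_probabilities.

Section iid_product.
Context d (T : measurableType d) (R : realType).

Definition cons_pair n (z : T * n.-tuple T) : n.+1.-tuple T :=
  [tuple of z.1 :: z.2].

Lemma measurable_cons_pair n : measurable_fun setT (@cons_pair n).
Proof. by apply: measurable_cons. Qed.

HB.instance Definition _ n :=
  isMeasurableFun.Build _ _ _ _ (@cons_pair n) (@measurable_cons_pair n).

(* n-fold power of P on n.-tuple T, whose sigma-algebra is the product one *)
Fixpoint iid_prob (P : probability T R) n : probability (n.-tuple T) R :=
  if n is k.+1 then distribution (prod_prob P (iid_prob P k)) (@cons_pair k)
  else dirac [tuple].

Lemma iid_probE (P : probability T R) n (A : 'I_n -> set T) :
  (forall i, measurable (A i)) ->
  iid_prob P n [set t | forall i, A i (tnth t i)] =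
  (\prod_(i < n) P (A i))%E.
Proof.
elim: n A => [|n IHn] A mA /=.
  rewrite big_ord0 diracE mem_set //=; by case.
rewrite big_ord_recl -IHn//= /distribution /pushforward /prod_prob.
rewrite -product_measure1E//; last first.
  rewrite (_ : mkset _ = \bigcap_(i in [set: 'I_n])
     ((fun t : n.-tuple T => tnth t i) @^-1` A (lift ord0 i))).
    apply: fin_bigcap_measurable => // i _.
    by rewrite -[X in measurable X]setTI; apply: measurable_tnth.
  by apply/seteqP; split=> t /= h i; [move=> _|]; exact: h.
congr ((_ \x _)%E _); apply/seteqP; split => -[x t] /= h.
  split; first by have := h ord0; rewrite tnth0.
  by move=> i; have := h (lift ord0 i); rewrite /cons_pair tnthS.
by move=> i; case: (unliftP ord0 i) => [j ->|->]; rewrite /cons_pair ?tnthS ?tnth0; case: h.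
Qed.
End iid_product.

Section aces.
Context (R : realType) (d : nat).

Local Notation space := (d.-tuple (measurableTypeR R)).

Definition vadd (x e : space) : space := [tuple tnth x i + tnth e i | i < d].

(* N(0, sigma^2 I); the second parameter of normal_prob is the standard
   deviation *)
Definition gauss (sigma : R) : probability space R :=
  iid_prob (normal_prob 0 sigma : probability (measurableTypeR R) R) d.

(* measurability with respect to the discrete sigma-algebra on the label set *)
Definition classifier_measurable (L : finType) (F : space -> L) :=
  forall c : L, measurable (F @^-1` [set c]).

(* an argmax operator with a fixed, arbitrary tie-breaking rule *)
Definition is_argmax (L : finType) (am : {ffun L -> \bar R} -> L) :=
  forall (p : {ffun L -> \bar R}) (c : L), (p c <= p (am p))%E.

Definition smoothed (L : finType) (am : {ffun L -> \bar R} -> L) (sigma : R)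
    (F : space -> L) (x : space) : L :=
  am [ffun c => gauss sigma [set e | F (vadd x e) = c]].

Section classifiers.
(* the selector's labels 0 and 1 are false and true; the m classes are
   numbered from 0, as the elements of 'I_m *)
Context (m : nat) (FSelect : space -> bool) (FCertify FCore : space -> 'I_m).

Definition F_ACES (amS : {ffun bool -> \bar R} -> bool)
    (amC : {ffun 'I_m -> \bar R} -> 'I_m) (sigma : R) (x : space) : 'I_m :=
  if smoothed amS sigma FSelect x then smoothed amC sigma FCertify x
  else FCore x.

Lemma F_ACESE amS amC sigma x :
  F_ACES amS amC sigma x =
  (smoothed amS sigma FSelect x * smoothed amC sigma FCertify x +
   (1 - smoothed amS sigma FSelect x) * FCore x)%N :> nat.
Proof.
by rewrite /F_ACES; case: ifP => _; rewrite ?mul1n ?mul0n ?addn0.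
Qed.

Definition label_counts (L : finType) n (F : space -> L) (x : space)
    (eps : 'I_n -> space) : {ffun L -> nat} :=
  [ffun c => #|[set i : 'I_n | F (vadd x (eps i)) == c]%SET|].

Definition binom_pvalue (k N : nat) (p : R) : \bar R :=
  binomial_prob N p [set j : nat | (k <= j)%N].

(* an operator returning the indices of the largest and the second largest
   entries, with a fixed, arbitrary tie-breaking rule *)
Definition is_top2 (L : finType) (top2 : {ffun L -> nat} -> L * L) :=
  forall cnt : {ffun L -> nat},
    [/\ (top2 cnt).1 != (top2 cnt).2,
        forall c, (cnt c <= cnt (top2 cnt).1)%N &
        forall c, c != (top2 cnt).1 -> (cnt c <= cnt (top2 cnt).2)%N].

(* epsS and epsC are the noise vectors drawn by the two calls of the sampling
   subroutine; None is abstention *)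
Definition predict (top2 : {ffun 'I_m -> nat} -> 'I_m * 'I_m) (x : space)
    (n : nat) (alpha : R) (epsS epsC : 'I_n -> space) : option 'I_m :=
  let countsS := label_counts FSelect x epsS in
  let countsC := label_counts FCertify x epsC in
  let n0 := countsS false in
  let n1 := countsS true in
  let cA := (top2 countsC).1 in
  let cB := (top2 countsC).2 in
  let nA := countsC cA in
  let nB := countsC cB in
  let rhoA := binom_pvalue nA (nA + nB) (1 / 2) in
  if [&& (n0 < n1)%N, (binom_pvalue n1 n (1 / 2) <= (alpha / 2)%:E)%E
       & (rhoA <= (alpha / 2)%:E)%E] then Some cA
  else if (n1 < n0)%N && (binom_pvalue n0 n (1 / 2) <= (alpha / 2)%:E)%E
       then Some (FCore x)
  else if (cA == FCore x) && (rhoA <= (alpha / 2)%:E)%E then Some cA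
  else None.

End classifiers.
End aces.

Definition mutually_independent (R : realType) dO (Omega : measurableType dO)
    (P : probability Omega R) dT (T : measurableType dT) (I : finType)
    (X : I -> {RV P >-> T}) :=
  forall (J : {set I}) (A : I -> set T), (forall i, measurable (A i)) ->
    P [set w | forall i, i \in J -> A i (X i w)] =
    (\prod_(i in J) P [set w | A i (X i w)])%E.

Definition sum_family (A B C : Type) (f : A -> C) (g : B -> C) (k : A + B) : C :=
  match k with inl a => f a | inr b => g b end.

(* Main.v *)
Require Import Defs.
From mathcomp Require Import all_boot all_order all_algebra.
From mathcomp Require Import ring lra zify.

Set Implicit Arguments.
Unset Strict Implicit.
Unset Printing Implicit Defensive.

Import Order.TTheory GRing.Theory Num.Theory.

Local Open Scope ring_scope.

(** Put [h = alpha / 2]. A union bound over the two tests is not enough: with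
    more than two classes, the probability [e] that some wrong class is verified
    at level [h] is only bounded by [2 * h], while for one given wrong class it is
    at most [h].

    If the smoothed selector is 0, only a wrong significant selector test can lead
    to an error, which costs [h]. If it is 1, let [a] and [b] be the probabilities
    that the selector test significantly reports 1 and 0. By independence of the
    two samples, the error is at most [b + a * e + (1 - a - b) * h], because the
    third branch can only return one wrong class, [FCore x]. The monotone
    likelihood ratio of binomial laws gives [(1 - h) * b <= h * (1 - a)], and with
    [e <= 2 * h] the total is at most [2 * h = alpha].

    Each bound on a test reduces to one comparison of binomial tails: given the
    positions labelled by two competing labels [g] and [c] with [p g <= p c], the
    number of [g]'s is binomial with success probability at most 1/2. *)

(** * Binomial tails *)

(** Splitting the sums from [t] at [k], the product of the two tails from [k] cancels; the rest is
    compared term by term over pairs [i < k <= j]. *)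
Lemma mlr_tail (R : realFieldType) (w w' : nat -> R) (t k n : nat) :
  (t <= k <= n)%N -> (forall i, 0 <= w i) -> (forall i, 0 <= w' i) ->
  (forall i j, (i <= j < n)%N -> w j * w' i <= w i * w' j) ->
  (\sum_(k <= j < n) w j) * (\sum_(t <= i < n) w' i) <=
  (\sum_(k <= j < n) w' j) * (\sum_(t <= i < n) w i).
Proof.
move=> /andP[tk kn] w0 w'0 ww'.
rewrite !(@big_cat_nat _ _ _ k t n) //= !mulrDr.
rewrite [X in _ + X <= _]mulrC lerD2r [leRHS]mulrC !mulr_suml.
rewrite !(eq_bigr _ (fun i _ => mulr_sumr _ _ _ _)) [leRHS]exchange_big /=.
rewrite ler_sum_nat // => j /andP[kj jn].
rewrite ler_sum_nat // => i /andP[ti ik].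
by apply: ww'; rewrite jn andbT (leq_trans (ltnW ik)).
Qed.

(** Consecutive [j] are compared through [(j+1) C(N,j+1) = (N-j) C(N,j)], and induction on [j]
    chains the comparisons. *)
Lemma bin_mlr (N N' i j : nat) : (N <= N')%N -> (i <= j)%N ->
  ('C(N, j) * 'C(N', i) <= 'C(N, i) * 'C(N', j))%N.
Proof.
move=> NN'; move: j; have step j : ('C(N, j.+1) * 'C(N', j) <= 'C(N, j) * 'C(N', j.+1))%N.
  rewrite -(@leq_pmul2l j.+1) // mulnA mul_bin_left [leqRHS]mulnCA mul_bin_left.
  by rewrite -mulnA [leqRHS]mulnCA leq_mul2r leq_sub2r // orbT.
elim=> [|j IH]; first by rewrite leqn0 => /eqP->.
rewrite leq_eqVlt => /orP[/eqP->|]; first by rewrite mulnC.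
rewrite ltnS => ij; have := IH ij; have := step j.
have [jN|jN] := leqP j N; last by rewrite (@bin_small N j.+1) // ltnW.
have : (0 < 'C(N, j))%N by rewrite bin_gt0.
move: ('C(N, j)) ('C(N, i)) ('C(N', i)) ('C(N, j.+1)) ('C(N', j)) ('C(N', j.+1)).
move=> a b c x y z a0 h1 h2.
have : (0 < y \/ y = 0)%N by lia.
case=> y0; last by subst y; rewrite muln0 leqn0 muln_eq0 in h2; nia.
rewrite -(@leq_pmul2l (a * y)) ?muln_gt0 ?a0 //.
have -> : (a * y * (x * c) = (a * c) * (x * y))%N by ring.
have -> : (a * y * (b * z) = (b * y) * (a * z))%N by ring.
exact: leq_mul.
Qed.

(** This is [2 ^+ N] times the p-value of [j] successes among [N] fair coins. *)
Definition bin_tail (R : pzSemiRingType) (N j : nat) : R :=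
  \sum_(j <= i < N.+1) 'C(N, i)%:R.

Lemma bin_tail0 (R : realFieldType) N : bin_tail R N 0 = 2 ^+ N.
Proof.
rewrite /bin_tail -[2]/(1 + 1) exprDn big_mkord; apply: eq_bigr => i _.
by rewrite !expr1n mulr1.
Qed.

Lemma bin_tail_rev (R : realFieldType) N j : (j <= N)%N ->
  bin_tail R N (N - j).+1 = 2 ^+ N - bin_tail R N j.
Proof.
move=> jN; rewrite -bin_tail0 /bin_tail [X in X - _](@big_cat_nat _ _ _ j) //=; last exact: leqW.
rewrite addrK [RHS]big_nat_rev /= -[(N - j).+1]add0n big_addn.
rewrite (_ : (N.+1 - (N - j).+1 = j)%N); last by lia.
apply: eq_big_nat => i /andP[_ it]; rewrite -bin_sub; last by lia.
by congr ('C(_, _)%:R); lia.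
Qed.

(** The reflection of [i] to [N - i] carries the [t] coefficients below the tail into the tail. *)
Lemma bin_tail_half (R : realFieldType) (N t : nat) : (t.*2 <= N.+1)%N ->
  2^-1 * 2 ^+ N <= bin_tail R N t.
Proof.
move=> tN.
have tN1 : (t <= N.+1)%N by lia.
rewrite -bin_tail0 /bin_tail (@big_cat_nat _ _ _ t 0 N.+1) //=.
suff: \sum_(0 <= i < t) 'C(N, i)%:R <= \sum_(t <= i < N.+1) 'C(N, i)%:R :> R by lra.
rewrite [leRHS](@big_cat_nat _ _ _ (N.+1 - t) t N.+1) /=; [|lia|lia].
rewrite (_ : \sum_(N.+1 - t <= i < N.+1) _ = \sum_(0 <= i < t) 'C(N, i)%:R :> R).
  by rewrite lerDr sumr_ge0.
rewrite [RHS]big_nat_rev /= -{1}[(N.+1 - t)%N]add0n big_addn.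
rewrite (_ : (N.+1 - (N.+1 - t) = t)%N); last by lia.
apply: eq_big_nat => i /andP[_ it]; rewrite add0n -bin_sub; last by lia.
by congr ('C(_, _)%:R); lia.
Qed.

(** Binomial weights without the normalisation [p + q = 1], since [p] and [q] will be the
    probabilities of two labels among many. *)
Definition binw (R : pzSemiRingType) (p q : R) (N j : nat) : R :=
  (p ^+ j * q ^+ (N - j)) *+ 'C(N, j).

(* For [p <= q], the likelihood ratio of [binw p q N j] to the weight ['C(N', j)] of
   at least as many fair coins decreases in [j]. Only the least element [k] of [S]
   matters, since [S] may be enlarged to all [j >= k]. *)
Lemma binom_upper_tail (R : realFieldType) (p q beta gamma : R) (N t : nat)
    (S : pred nat) : 0 <= p <= q -> 0 <= beta ->
  (forall j, (j <= N)%N -> S j -> exists2 N', (t <= j <= N')%N && (N <= N')%N &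
     bin_tail R N' j <= beta * 2 ^+ N' /\
     gamma * 2 ^+ N' <= bin_tail R N' t) ->
  gamma * \sum_(j < N.+1 | S j) binw p q N j <=
  beta * \sum_(j < N.+1 | (t <= j)%N) binw p q N j.
Proof.
move=> /andP[p0 pq] b0 H; have q0 := le_trans p0 pq.
have w0 j : 0 <= binw p q N j by rewrite mulrn_wge0 // mulr_ge0 // exprn_ge0.
case: (boolP [exists j : 'I_N.+1, S j]) => [/existsP[j0 Sj0]|/existsPn noS]; last first.
  rewrite big1 ?mulr0 ?mulr_ge0 ?sumr_ge0 // => j Sj.
  by have := noS j; rewrite Sj.
have ex : exists j, (j <= N)%N && S j by exists j0; rewrite -ltnS ltn_ord.
case: (ex_minnP ex) => k /andP[kN Sk] kmin.
have [N' /andP[/andP[tk kN'] NN'] [h1 h2]] := H k kN Sk.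
set K := \sum_(k <= j < N'.+1) binw p q N j.
set W := \sum_(t <= j < N'.+1) binw p q N j.
have K0 : 0 <= K by apply: sumr_ge0.
have W0 : 0 <= W by apply: sumr_ge0.
have hK : \sum_(j < N.+1 | S j) binw p q N j <= K.
  rewrite /K (@big_cat_nat _ _ _ N.+1 k N'.+1) /=; [|lia|lia].
  apply: le_trans (_ : _ <= \sum_(k <= j < N.+1) binw p q N j) _.
    rewrite big_geq_mkord /= [leLHS]big_mkcond [leRHS]big_mkcond ler_sum // => j _.
    case: ifP => Sj; last by case: ifP.
    by rewrite kmin // Sj andbT -ltnS.
  by rewrite lerDl sumr_ge0.
have hW : W = \sum_(j < N.+1 | (t <= j)%N) binw p q N j.
  rewrite /W (@big_cat_nat _ _ _ N.+1 t N'.+1) /=; [|lia|lia].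
  rewrite [X in _ + X]big_nat [X in _ + X]big1 ?addr0.
    by rewrite big_geq_mkord.
  by move=> j /andP[Nj _]; rewrite /binw bin_small.
have main : K * bin_tail R N' t <= bin_tail R N' k * W.
  apply: mlr_tail => //; first by lia.
  move=> i j /andP[ij jN']; rewrite /binw.
  have [jN|jN] := leqP j N; last first.
    by rewrite (bin_small jN) mulr0n mul0r mulr_ge0 //; exact: w0.
  rewrite !mulr_natr -!mulrnA.
  (* Going from [j] down to [i] replaces [p ^+ (j - i)] by [q ^+ (j - i)], an increase since
     [p <= q]; [bin_mlr] compares the coefficients. *)
  apply: le_trans (_ : (p ^+ i * q ^+ (N - i)) *+ ('C(N, j) * 'C(N', i)) <= _).
    rewrite lerMn2r; apply/orP; right.
    rewrite -(subnKC ij) exprD -mulrA ler_wpM2l ?exprn_ge0 //.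
    rewrite (_ : (N - i = (j - i) + (N - (i + (j - i))))%N); last by lia.
    rewrite exprD ler_wpM2r ?exprn_ge0 //.
    by rewrite lerXn2r ?nnegrE.
  by rewrite ler_wpMn2l ?mulr_ge0 ?exprn_ge0 // bin_mlr.
rewrite -hW.
case: (lerP 0 gamma) => g0; last first.
  apply: (@le_trans _ _ 0); last by rewrite mulr_ge0.
  by rewrite mulr_le0_ge0 ?(ltW g0) ?sumr_ge0.
apply: (le_trans (ler_wpM2l g0 hK)).
have e0 : 0 < 2 ^+ N' :> R by rewrite exprn_gt0.
rewrite -(ler_pM2r e0).
have := ler_wpM2l K0 h2; have := ler_wpM2r W0 h1.
move: main; lra.
Qed.

(** * Words with independent letters *)

Section words.
Context (I L : finType).

Definition counts (v : {ffun I -> L}) : {ffun L -> nat} :=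
  [ffun c => #|[set i | v i == c]|].

Definition recolor (g : L) (r : {ffun I -> L}) (B : {set I}) : {ffun I -> L} :=
  [ffun i => if i \in B then g else r i].

Context (R : realFieldType) (p : L -> R).

Definition word_weight (v : {ffun I -> L}) : R := \prod_i p (v i).

Lemma sum_word_weight : \sum_c p c = 1 -> \sum_v word_weight v = 1.
Proof.
move=> p1; rewrite /word_weight -(bigA_distr_bigA (fun _ : I => p)) /=.
by rewrite big1 // => i _.
Qed.

(** Turning each [g] into [c] maps a word to a [g]-free word [r]; the fibre over [r] is indexed by
    the set of [c]-positions of [r] that carried [g]. *)
Lemma sum_words_recolor (g c : L) (A : pred {ffun I -> L}) : g != c ->
  \sum_(v | A v) word_weight v =
  \sum_(r | counts r g == 0)
    \sum_(B : {set I} | (B \subset [set i | r i == c]) && A (recolor g r B))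
       word_weight (recolor g r B).
Proof.
move=> gc.
pose collapse (v : {ffun I -> L}) := [ffun i => if v i == g then c else v i].
have counts0 (r : {ffun I -> L}) : (counts r g == 0) = [forall i, r i != g].
  rewrite ffunE cards_eq0; apply/eqP/forallP => [r0 i|rg].
    by have := in_set0 i; rewrite -r0 inE => ->.
  by apply/setP => i; rewrite !inE; apply/negbTE.
rewrite (partition_big collapse (fun r => counts r g == 0)) /=; last first.
  move=> v _; rewrite counts0; apply/forallP => i; rewrite ffunE.
  by case: ifP => [_|->//]; rewrite eq_sym.
apply: eq_bigr => r; rewrite counts0 => /forallP rg.
rewrite (reindex_onto (recolor g r) (fun v => [set i | v i == g])) /=; last first.
  move=> v /andP[_ /eqP <-]; apply/ffunP => i; rewrite !ffunE inE.
  by case: eqP => [->|].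
apply: eq_bigl => B.
have -> : [set i | recolor g r B i == g] = B.
  apply/setP => i; rewrite inE ffunE; case: ifP => _; first exact: eqxx.
  exact/negbTE/rg.
rewrite eqxx andbT andbC; congr (_ && _).
apply/eqP/subsetP => [<- i iB|BT].
  by rewrite inE !ffunE iB eqxx.
apply/ffunP => i; rewrite !ffunE; case iB: (i \in B).
  by rewrite eqxx; apply/esym/eqP; have := BT _ iB; rewrite inE.
by rewrite (negbTE (rg i)).
Qed.

Lemma counts_recolor (g c : L) (r : {ffun I -> L}) (B : {set I}) h :
  g != c -> counts r g = 0 ->
  B \subset [set i | r i == c] ->
  counts (recolor g r B) h =
  if h == g then #|B| else if h == c then (counts r c - #|B|)%N else counts r h.
Proof.
move=> gc r0 /subsetP BT.
have rg i : r i != g.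
  by apply/eqP => rig; have : i \in [set i | r i == g];
     [rewrite inE rig | move: r0; rewrite ffunE => /cards0_eq ->; rewrite inE].
rewrite !ffunE; case: eqVneq => [->|hg].
  congr #|pred_of_set _|; apply/setP => i; rewrite inE ffunE; case: ifP => _; first exact: eqxx.
  exact/negbTE/rg.
case: eqVneq => [->|hc].
  rewrite -cardsDS; last exact/subsetP.
  congr #|pred_of_set _|; apply/setP => i; rewrite !inE ffunE; case: ifP => // _.
  by rewrite (negbTE gc).
congr #|pred_of_set _|; apply/setP => i; rewrite !inE ffunE; case: ifP => // iB.
have := BT _ iB; rewrite inE => /eqP ->.
by rewrite eq_sym (negbTE hg) eq_sym (negbTE hc).
Qed.

Lemma sum_subsets_card (T : {set I}) (S : pred nat) (x y : R) :
  \sum_(B : {set I} | (B \subset T) && S #|B|) x ^+ #|B| * y ^+ (#|T| - #|B|) =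
  \sum_(j < #|T|.+1 | S j) binw x y #|T| j.
Proof.
rewrite (partition_big (fun B : {set I} => inord #|B| : 'I_#|T|.+1)
           (fun j : 'I_#|T|.+1 => S j)) /=; last first.
  by move=> B /andP[/subset_leq_card BT SB]; rewrite inordK.
apply: eq_bigr => j Sj; rewrite /binw -cards_draws -sumr_const.
apply: eq_big => [B|B /andP[/andP[BT SB] /eqP <-]]; last first.
  by rewrite inordK // ltnS subset_leq_card.
rewrite inE; case BT: (B \subset T) => //=.
have BT' : (#|B| < #|T|.+1)%N by rewrite ltnS subset_leq_card.
apply/andP/eqP => [[_ /eqP <-]|Bj]; first by rewrite inordK.
by rewrite Bj Sj; split=> //; apply/eqP/val_inj; rewrite /= inordK.
Qed.

Lemma word_weight_recolor (g c : L) (r : {ffun I -> L}) (B : {set I}) :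
  B \subset [set i | r i == c] ->
  word_weight (recolor g r B) =
  p g ^+ #|B| * p c ^+ (counts r c - #|B|) * \prod_(i | r i != c) p (r i).
Proof.
move=> BT; rewrite /word_weight (bigID (fun i => r i == c)) /=; congr (_ * _).
  rewrite (bigID (mem B)) /= !ffunE -cardsDS //; congr (_ * _).
    rewrite -prodr_const; apply: eq_big => [i|i /andP[_ iB]]; last by rewrite ffunE iB.
    by apply: andb_idl => iB; have := subsetP BT _ iB; rewrite inE.
  rewrite -prodr_const; apply: eq_big => [i|i /andP[/eqP ri /negbTE iB]].
    by rewrite !inE andbC.
  by rewrite ffunE iB ri.
apply: eq_bigr => i ri; rewrite ffunE; case: ifP => // iB.
by have := subsetP BT _ iB; rewrite inE (negbTE ri).
Qed.

(* Conditioning on everything except which of the positions labelled [g] or [c]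
   carry [g] turns the number of [g]'s into a binomial variable. *)
Lemma words_upper_tail (g c : L) (A A' : pred {ffun I -> L}) (beta gamma : R) :
  g != c -> (forall l, 0 <= p l) -> p g <= p c -> 0 <= beta ->
  (forall r, counts r g = 0 -> exists t,
     (forall B : {set I}, B \subset [set i | r i == c] -> (t <= #|B|)%N ->
        A' (recolor g r B)) /\
     (forall B : {set I}, B \subset [set i | r i == c] -> A (recolor g r B) ->
        exists2 N', (t <= #|B| <= N')%N && (counts r c <= N')%N &
          bin_tail R N' #|B| <= beta * 2 ^+ N' /\
          gamma * 2 ^+ N' <= bin_tail R N' t)) ->
  gamma * \sum_(v | A v) word_weight v <= beta * \sum_(v | A' v) word_weight v.
Proof.
move=> gc p0 pgc b0 H; rewrite !(sum_words_recolor _ gc) !mulr_sumr.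
apply: ler_sum => r /eqP r0; have [t [HA' HA]] := H r r0.
set T := [set i | r i == c]; set q := \prod_(i | r i != c) p (r i).
have q0 : 0 <= q by apply: prodr_ge0.
have cT : counts r c = #|T| by rewrite ffunE.
(* [A] may depend on [B] beyond its size. It is enlarged to all subsets whose size occurs, which is
   harmless because the bounds in [HA] involve only [#|B|]. *)
pose S j := [exists B : {set I}, [&& B \subset T, #|B| == j & A (recolor g r B)]].
have wE (B : {set I}) : B \subset T -> word_weight (recolor g r B) =
    p g ^+ #|B| * p c ^+ (#|T| - #|B|) * q.
  by move=> BT; rewrite (word_weight_recolor _ BT) cT.
have w0 v : 0 <= word_weight v by apply: prodr_ge0.
case: (lerP 0 gamma) => g0; last first.
  apply: (@le_trans _ _ 0); last by rewrite mulr_ge0 ?sumr_ge0.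
  by rewrite mulr_le0_ge0 ?(ltW g0) ?sumr_ge0.
apply: (@le_trans _ _ (gamma * (\sum_(j < #|T|.+1 | S j) binw (p g) (p c) #|T| j) * q)).
  rewrite -mulrA ler_wpM2l // -(@sum_subsets_card T S) mulr_suml.
  rewrite [leLHS]big_mkcond [leRHS]big_mkcond ler_sum // => B _.
  case BT: (B \subset T) => //=; case AB: (A _).
    by rewrite ifT ?wE //; apply/existsP; exists B; rewrite BT AB eqxx.
  by case: ifP => // _; rewrite -wE.
apply: (@le_trans _ _ (beta * (\sum_(j < #|T|.+1 | (t <= j)%N) binw (p g) (p c) #|T| j) * q)).
  rewrite ler_wpM2r //; apply: binom_upper_tail => //; first by rewrite p0.
  move=> j jT /existsP[B /and3P[BT /eqP <- AB]].
  by have [N' h1 h2] := HA _ BT AB; exists N' => //; rewrite -cT.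
rewrite -mulrA ler_wpM2l // -(@sum_subsets_card T (fun j => (t <= j)%N)) mulr_suml.
rewrite [leLHS]big_mkcond [leRHS]big_mkcond ler_sum // => B _.
case BT: (B \subset T) => //=; case: ifP => tB; last by case: ifP.
by rewrite HA' // wE.
Qed.

End words.

(** * The two tests *)

Section tests.
Context (R : realFieldType) (h : R).

(** The test [rhoA <= h], cleared of its denominator. *)
Definition verified (L : finType) (cnt : {ffun L -> nat}) (a b : L) :=
  bin_tail R (cnt a + cnt b) (cnt a) <= h * 2 ^+ (cnt a + cnt b).

(** [n - k] is the count of the opposite label, so the first conjunct asks for a strict majority. *)
Definition selected (n k : nat) :=
  (n - k < k)%N && (bin_tail R n k <= h * 2 ^+ n).

Lemma verified_winner_le (I L : finType) (p : L -> R) (g c : L)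
    (top2 : {ffun L -> nat} -> L * L) :
  is_top2 top2 -> (forall l, 0 <= p l) -> \sum_l p l = 1 ->
  g != c -> p g <= p c -> 0 <= h ->
  \sum_(v : {ffun I -> L} | ((top2 (counts v)).1 == g) &&
      verified (counts v) (top2 (counts v)).1 (top2 (counts v)).2)
    word_weight p v <= h.
Proof.
move=> htop p0 p1 gc pgc h0.
rewrite -[leLHS]mul1r -[leRHS]mulr1.
rewrite -[X in _ <= _ * X](@sum_word_weight I L R p p1).
apply: (@words_upper_tail I L R p g c _ predT) => // r r0; exists 0%N; split=> // B BT.
have := counts_recolor _ gc r0 BT; set v := recolor g r B => cE.
have [_ _ run] := htop (counts v).
case/andP => /eqP tg; rewrite /verified tg; set b := (top2 _).2 => ver.
rewrite tg -/b in run.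
have := run c; rewrite eq_sym gc => /(_ isT).
move: ver; rewrite (cE g) (cE c) eqxx (eq_sym c) (negbTE gc) eqxx => ver cb.
(* As [c] lost to [g], the runner-up [b] has at least the votes of [c]. The tested sample is thus no
   smaller than the [counts r c] positions shared by [g] and [c]. *)
exists (#|B| + counts v b)%N; first by rewrite leq0n leq_addr -leq_subLR.
by split=> //; rewrite bin_tail0 mul1r.
Qed.

(* The true top label [c] competes with each wrong winner [g] separately: given
   all other counts, [g] needs at least [t] votes to win, an event of probability
   at least 1/2 for fair coins, so that the conditional probability of a verified
   win is at most [2 * h]. Ties broken in favour of the smallest
   index, with [c] last, make the winning events of distinct [g] disjoint. *)
Lemma verified_wrong_winner_le (I : finType) (m : nat) (p : 'I_m -> R) (c : 'I_m)
    (top2 : {ffun 'I_m -> nat} -> 'I_m * 'I_m) :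
  is_top2 top2 -> (forall l, 0 <= p l) -> \sum_l p l = 1 ->
  (forall l, p l <= p c) -> 0 <= h < 2^-1 ->
  \sum_(v : {ffun I -> 'I_m} | ((top2 (counts v)).1 != c) &&
      verified (counts v) (top2 (counts v)).1 (top2 (counts v)).2)
    word_weight p v <= 2 * h.
Proof.
move=> htop p0 p1 pc /andP[h0 h12].
pose W g (v : {ffun I -> 'I_m}) := (counts v c <= counts v g)%N &&
  [forall l : 'I_m, (l != g) && (l != c) ==> (counts v l + (l < g) <= counts v g)%N].
have w0 v : 0 <= word_weight p v by apply: prodr_ge0.
have key g : g != c ->
    2^-1 * \sum_(v : {ffun I -> 'I_m} | ((top2 (counts v)).1 == g) &&
      verified (counts v) (top2 (counts v)).1 (top2 (counts v)).2)
    word_weight p v <= h * \sum_(v | W g v) word_weight p v.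
  move=> gc; apply: (@words_upper_tail I _ R p g c) => // r r0.
  set T := [set i | r i == c].
  pose M := (\max_(l | (l != g) && (l != c)) (counts r l + (l < g)))%N.
  (* The first bound gives [g] at least as many votes as [c]; [M] makes it beat all other labels
     under the tie-breaking of [W]. *)
  exists (maxn (uphalf (counts r c)) M).
  have cTE : #|T| = counts r c by rewrite ffunE.
  split=> B BT; have Bc : (#|B| <= counts r c)%N by rewrite -cTE subset_leq_card.
    have := counts_recolor _ gc r0 BT; set v := recolor g r B => cE.
    rewrite geq_max => /andP[tB MB]; apply/andP; split.
      by rewrite (cE g) (cE c) eqxx (eq_sym c) (negbTE gc) eqxx; lia.
    apply/forallP => l; apply/implyP => /andP[lg lc].
    rewrite (cE g) (cE l) eqxx (negbTE lg) (negbTE lc).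
    by move/bigmax_leqP: MB => /(_ l); rewrite lg lc; apply.
  have := counts_recolor _ gc r0 BT; set v := recolor g r B => cE.
  have [_ _ run] := htop (counts v).
  case/andP => /eqP tg; rewrite /verified tg; set b := (top2 _).2 => ver.
  rewrite tg -/b in run.
  have cb : (counts r c - #|B| <= counts v b)%N.
    have := run c; rewrite eq_sym gc => /(_ isT).
    by rewrite (cE c) (eq_sym c) (negbTE gc) eqxx.
  have Mb : (M <= (counts v b).+1)%N.
    apply/bigmax_leqP => l /andP[lg lc]; have := run l lg.
    rewrite (cE l) (negbTE lg) (negbTE lc) => lb; case: (l < g)%N.
      by rewrite addn1 ltnS.
    by rewrite addn0 leqW.
  move: ver; rewrite (cE g) eqxx => ver.
  set N := (#|B| + counts v b)%N in ver *.
  (* As [h < 1/2], a verified tail starts beyond the middle. The strict excess over [N.+1] absorbs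
     the unit that tie-breaking adds to [M], so the threshold lies below [#|B|] and its own tail has
     mass at least 1/2. *)
  have lt : (N.+1 < #|B|.*2)%N.
    rewrite ltnNge; apply/negP => /(@bin_tail_half R) H.
    have := le_trans H ver; rewrite ler_pM2r ?exprn_gt0 //.
    by rewrite leNgt h12.
  exists N; first by rewrite geq_max; lia.
  split=> //; apply: bin_tail_half; rewrite /maxn; case: ifP; lia.
rewrite (partition_big (fun v => (top2 (counts v)).1) (fun g => g != c)) /=; last first.
  by move=> v /andP[].
apply: (@le_trans _ _ (\sum_(g | g != c) 2 * h * \sum_(v | W g v) word_weight p v)).
  apply: ler_sum => g gc; rewrite -mulrA -ler_pdivrMl ?ltr0n //.
  apply: le_trans (key g gc); rewrite le_eqVlt; apply/orP; left; apply/eqP.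
  congr (_ * _); apply: eq_bigl => v.
  case: (eqVneq (top2 (counts v)).1 g) => [->|]; last by rewrite andbF.
  by rewrite gc andbT.
rewrite -mulr_sumr -[leRHS]mulr1 ler_wpM2l //; first by lra.
rewrite -[leRHS](@sum_word_weight I _ R p p1).
rewrite (exchange_big_dep predT) //=; apply: ler_sum => v _.
rewrite sumr_const -[leRHS]mulr1n ler_wpMn2l //.
apply/card_le1_eqP => g g'; rewrite !unfold_in.
wlog gg' : g g' / (g < g')%N => [hw|].
  case: (ltngtP g g') => [gg'|gg'|/val_inj //] H1 H2; first exact: hw.
  by apply/esym/hw.
move=> /andP[gc /andP[cg /forallP Wg]] /andP[g'c /andP[cg' /forallP Wg']].
have gne : g != g' by rewrite neq_ltn gg'.
have := Wg g'; have := Wg' g; rewrite gne gc eq_sym gne g'c gg' /=; lia.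
Qed.

(** With two labels, [words_upper_tail] applies with threshold 0 and [n] fair coins. *)
Lemma selected_wrong_le (n : nat) (p : bool -> R) (c : bool) :
  (forall l, 0 <= p l) -> \sum_l p l = 1 -> p (~~ c) <= p c -> 0 <= h ->
  \sum_(u : {ffun 'I_n -> bool} | selected n (counts u (~~ c))) word_weight p u
    <= h.
Proof.
move=> p0 p1 pc h0; have gc : ~~ c != c by case: c {pc}.
rewrite -[leLHS]mul1r -[leRHS]mulr1.
rewrite -[X in _ <= _ * X](@sum_word_weight 'I_n _ R p p1).
apply: (@words_upper_tail _ _ R p (~~ c) c _ predT) => // r r0; exists 0%N; split=> // B BT.
have := counts_recolor _ gc r0 BT; set v := recolor _ r B => cE.
rewrite (cE (~~ c)) eqxx => /andP[nB ver]; exists n.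
  rewrite leq0n /= -[X in (_ <= X)%N && _]card_ord max_card.
  by rewrite ffunE -[X in (_ <= X)%N]card_ord max_card.
by split=> //; rewrite bin_tail0 mul1r.
Qed.

Lemma counts_bool (I : finType) (u : {ffun I -> bool}) c :
  (counts u c + counts u (~~ c))%N = #|I|.
Proof.
rewrite !ffunE -[RHS](cardsC [set i | u i == c]); congr (_ + #|pred_of_set _|)%N.
by apply/setP => i; rewrite !inE; case: c; case: (u i).
Qed.

(* Monotone likelihood ratio: conditionally on the selector not reporting [c],
   a report of [~~ c] is most likely for a fair coin. *)
Lemma selected_odds (n : nat) (p : bool -> R) (c : bool) :
  (forall l, 0 <= p l) -> \sum_l p l = 1 -> p (~~ c) <= p c -> 0 <= h ->
  (1 - h) * \sum_(u : {ffun 'I_n -> bool} | selected n (counts u (~~ c)))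
              word_weight p u <=
  h * (1 - \sum_(u : {ffun 'I_n -> bool} | selected n (counts u c))
              word_weight p u).
Proof.
move=> p0 p1 pc h0; have gc : ~~ c != c by case: c {pc}.
have w0 (v : {ffun 'I_n -> bool}) : 0 <= word_weight p v by apply: prodr_ge0.
rewrite -[X in _ <= _ * (X - _)](@sum_word_weight 'I_n _ R p p1).
rewrite [X in _ <= _ * (X - _)](bigID (fun u : {ffun _} => selected n (counts u c))) /=.
rewrite [X in _ <= _ * X]addrC addKr.
case: (boolP [exists k : 'I_n.+1, selected n k]) => [/existsP[k0 Sk0]|/existsPn noS]; last first.
  rewrite big1 ?mulr0 ?mulr_ge0 ?sumr_ge0 // => u Su.
  have un : (counts u (~~ c) < n.+1)%N.
    by rewrite ltnS -[leqRHS]card_ord -(counts_bool u (~~ c)) leq_addr.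
  by have := noS (Ordinal un); rewrite /= Su.
have ex : exists j, (j <= n)%N && selected n j by exists k0; rewrite -ltnS ltn_ord.
case: (ex_minnP ex) => k /andP[kn Sk] kmin.
apply: (@words_upper_tail _ _ R p (~~ c) c) => // r r0.
(* [k] is the smallest count that passes the test. More than [n - k] votes for [~~ c] leave [c]
   fewer than [k], and this tail complements the one from [k], whence the factor [1 - h]. *)
exists (n - k).+1; split=> B BT; have := counts_recolor _ gc r0 BT;
  set v := recolor _ r B => cE.
  move=> kB; apply/negP => Sv; have := kmin (counts v c); rewrite Sv andbT.
  have := counts_bool v c; rewrite card_ord (cE (~~ c)) eqxx => cn.
  by move: cn kB kn; lia.
rewrite (cE (~~ c)) eqxx => /[dup] SB /andP[nB ver]; exists n.
  have Bn : (#|B| <= n)%N by rewrite -[leqRHS]card_ord max_card.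
  have := kmin #|B|; rewrite Bn SB => /(_ isT) kB.
  have rn : (counts r c <= n)%N by rewrite ffunE -[leqRHS]card_ord max_card.
  by rewrite rn !andbT; case/andP: Sk => nk _; move: nk kB; lia.
split=> //; rewrite bin_tail_rev // mulrBl mul1r lerD2l lerN2.
by case/andP: Sk.
Qed.

End tests.

(** * Error probability of the decision rule *)

Section decision.
Context (R : realFieldType) (h : R) (m n : nat).
Context (top2 : {ffun 'I_m -> nat} -> 'I_m * 'I_m) (core : 'I_m).

Definition decide (cntS : {ffun bool -> nat}) (cntC : {ffun 'I_m -> nat}) :
    option 'I_m :=
  let ver := verified h cntC (top2 cntC).1 (top2 cntC).2 in
  if selected h n (cntS true) && ver then Some (top2 cntC).1
  else if selected h n (cntS false) then Some core
  else if ((top2 cntC).1 == core) && ver then Some (top2 cntC).1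
  else None.

Lemma selected_excl (u : {ffun 'I_n -> bool}) :
  selected h n (counts u true) -> selected h n (counts u false) = false.
Proof.
move=> /andP[ut _]; apply/negbTE/nandP; left.
have := counts_bool u true; rewrite card_ord /=; move: ut.
by move: (counts u true) (counts u false) => a b; lia.
Qed.

(** The product of word weights encodes the independence of the two samples; [s] and [c] are
    arbitrary most probable labels, so every tie-breaking rule is covered. *)
Lemma decide_error (pS : bool -> R) (pC : 'I_m -> R) (s : bool) (c : 'I_m) :
  is_top2 top2 -> 0 <= h < 2^-1 ->
  (forall l, 0 <= pS l) -> \sum_l pS l = 1 -> pS (~~ s) <= pS s ->
  (forall l, 0 <= pC l) -> \sum_l pC l = 1 -> (forall l, pC l <= pC c) ->
  \sum_(u : {ffun 'I_n -> bool}) \sum_(v : {ffun 'I_n -> 'I_m})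
    (decide (counts u) (counts v)
       \notin [:: None; Some (if s then c else core)])%:R *
    (word_weight pS u * word_weight pC v) <= 2 * h.
Proof.
move=> htop /andP[h0 h12] pS0 pS1 pSs pC0 pC1 pCc.
have wS0 (u : {ffun 'I_n -> bool}) : 0 <= word_weight pS u by apply: prodr_ge0.
have wC0 (v : {ffun 'I_n -> 'I_m}) : 0 <= word_weight pC v by apply: prodr_ge0.
have condE (T : finType) (Q : pred T) (f : T -> R) :
    \sum_(t | Q t) f t = \sum_t (Q t)%:R * f t.
  by rewrite big_mkcond; apply: eq_bigr => t _; case: ifP => _; rewrite ?mul1r ?mul0r.
pose sel l (u : {ffun 'I_n -> bool}) := selected h n (counts u l).
pose ver (v : {ffun 'I_n -> 'I_m}) :=
  verified h (counts v) (top2 (counts v)).1 (top2 (counts v)).2.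
case: s pSs => pSs.
- pose wrong v := ((top2 (counts v)).1 != c) && ver v.
  (* The third branch returns [core], an error only if [core != c]. The wrong winner is thus fixed
     in advance, as [verified_winner_le] requires. *)
  pose wrong_core v := [&& core != c, (top2 (counts v)).1 == core & ver v].
  set b := \sum_(u | sel false u) word_weight pS u.
  set a := \sum_(u | sel true u) word_weight pS u.
  set e := \sum_(v | wrong v) word_weight pC v.
  set f := \sum_(v | wrong_core v) word_weight pC v.
  have bE : b = \sum_u (sel false u)%:R * word_weight pS u by exact: condE.
  have aE : a = \sum_u (sel true u)%:R * word_weight pS u by exact: condE.
  have eE : e = \sum_v (wrong v)%:R * word_weight pC v by exact: condE.
  have fE : f = \sum_v (wrong_core v)%:R * word_weight pC v by exact: condE.
  have he : e <= 2 * h by apply: verified_wrong_winner_le => //; rewrite h0.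
  have hf : f <= h.
    rewrite /f /wrong_core; case: (eqVneq core c) => [_|cc].
      by rewrite big_pred0.
    exact: (@verified_winner_le R h _ _ pC core c).
  have hab : (1 - h) * b <= h * (1 - a) by exact: (@selected_odds R h n pS true).
  have a0 : 0 <= a by apply: sumr_ge0.
  pose ind (l : bool) u : R := (sel l u)%:R.
  have hm : \sum_u (1 - ind true u - ind false u) * word_weight pS u = 1 - a - b.
    rewrite aE bE -[X in _ = X - _ - _](@sum_word_weight 'I_n _ R pS pS1).
    rewrite -!sumrB.
    by apply: eq_bigr => u _; rewrite !mulrBl mul1r.
  have m0 : 0 <= 1 - a - b.
    rewrite -hm; apply: sumr_ge0 => u _; rewrite mulr_ge0 // /ind /sel.
    case: (boolP (selected _ _ (counts u true))) => [/selected_excl -> /=|_ /=].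
      by rewrite subr0 subrr.
    by rewrite subr0; case: (selected _ _ _); rewrite /= ?subrr ?subr0.
  (* With [e <= 2 * h] and [f <= h] the sum is at most [(1 - h) * b + a * h + h], which [hab] bounds
     by [2 * h]. *)
  apply: (@le_trans _ _ (b * 1 + a * e + (1 - a - b) * f)); last by nra.
  rewrite -hm aE bE eE fE -[X in _ * X + _ + _](@sum_word_weight 'I_n _ R pC pC1).
  rewrite !big_distrlr /= -!big_split /=; apply: ler_sum => u _.
  rewrite -!big_split /=; apply: ler_sum => v _.
  have := mulr_ge0 (wS0 u) (wC0 v); move: (wS0 u) (wC0 v).
  move: (word_weight pS u) (word_weight pC v) => x y x0 y0 xy0.
  rewrite /ind /sel /wrong /wrong_core /ver /decide.
  case: (boolP (selected _ _ (counts u true))) => [/selected_excl ->|_] /=.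
    case vv: (verified _ _ _ _); rewrite ?inE ?andbF /=; last by rewrite /=; lra.
    by rewrite (inj_eq Some_inj); case: eqP => _ /=; lra.
  case: (selected _ _ _) => /=.
    rewrite subr0 subrr !mul0r !addr0 !mul1r.
    by case: (_ \notin _); rewrite ?mul1r ?mul0r.
  case: eqVneq => [->|_] /=; last by rewrite andbF /=; lra.
  case vv: (verified _ _ _ _); rewrite ?inE ?andbF ?andbT /=; last by lra.
  by rewrite (inj_eq Some_inj); case: eqP => _ /=; lra.
(* The target is now [core], which the second and third branches return, so an error requires the
   selector test to report 1. *)
- apply: (@le_trans _ _ (\sum_(u | sel true u) word_weight pS u *
      \sum_(v : {ffun 'I_n -> 'I_m}) word_weight pC v)); last first.
    rewrite (sum_word_weight _ pC1); under eq_bigr do rewrite mulr1.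
    apply: (@le_trans _ _ h); last by lra.
    exact: (@selected_wrong_le _ _ _ _ false).
  rewrite [leRHS]condE.
  apply: ler_sum => u _; rewrite !mulr_sumr; apply: ler_sum => v _.
  move: (mulr_ge0 (wS0 u) (wC0 v)).
  move: (word_weight pS u * word_weight pC v) => z z0.
  rewrite /sel /decide; case: (selected _ _ (counts u true)) => /=.
    by rewrite mul1r; case: (_ \notin _); rewrite ?mul1r ?mul0r.
  case: (selected _ _ _); first by rewrite ?inE eqxx /=; lra.
  case: eqVneq => [->|_] /=; last by rewrite ?inE /=; lra.
  by case: ifP => _; rewrite ?inE ?eqxx /=; lra.
Qed.

End decision.

(** * Sampling *)

From mathcomp Require Import all_classical all_reals all_analysis.

Local Open Scope classical_set_scope.

(** Finite additivity over the fibres of [X]; as [K] carries no sigma-algebra, measurability is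
    stated for each fibre. *)
Lemma measure_finite_range d (T : measurableType d) (R : realType)
    (mu : {measure set T -> \bar R}) (K : finType) (X : T -> K) (Q : pred K) :
  (forall k, measurable (X @^-1` [set k])) ->
  mu [set w | Q (X w)] = (\sum_(k | Q k) mu (X @^-1` [set k]))%E.
Proof.
move=> mX.
have finQ : finite_set [set k | Q k] by exact: finite_finset.
have -> : [set w | Q (X w)] = \bigcup_(k in [set k | Q k]) (X @^-1` [set k]).
  by apply/seteqP; split=> [w Qw|w [k Qk /= ->//]]; exists (X w).
rewrite measure_fin_bigcup //; last by move=> i j _ _ [w [/= <- <-]].
rewrite fsbig_finite //=.
rewrite -[RHS]big_filter.
apply: perm_big; apply: uniq_perm; rewrite ?finmap.fset_uniq ?filter_uniq ?index_enum_uniq //.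
move=> k; rewrite in_fset_set // seq.mem_filter mem_index_enum andbT.
by apply/idP/idP; rewrite inE.
Qed.

Lemma measurable_vadd (R : realType) d (x : d.-tuple (measurableTypeR R)) :
  measurable_fun setT (vadd x).
Proof.
apply/measurable_fun_tnthP => i.
rewrite (_ : _ \o _ = fun e : d.-tuple (measurableTypeR R) => tnth x i + tnth e i).
  apply: measurable_realfun.measurable_funD => //; exact: measurable_tnth.
by apply/funext => e /=; rewrite tnth_mktuple.
Qed.

Lemma binom_pvalue_le (R : realType) (k N : nat) (h : R) :
  (binom_pvalue k N (1 / 2) <= h%:E)%E = (bin_tail R N k <= h * 2 ^+ N).
Proof.
have p0 : 0 <= 1 / 2 :> R by rewrite divr_ge0.
have p1 : (NngNum p0)%:num <= 1 by rewrite /= div1r invf_le1 ?ler1n.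
rewrite /binom_pvalue (@binomial_probE _ _ _ p0 p1).
rewrite (_ : (\sum_(_ < _) _)%E = (bin_tail R N k / 2 ^+ N)%:E); last first.
  rewrite /bin_tail big_geq_mkord /= mulr_suml -sumEFin [RHS]big_mkcond /=.
  apply: eq_bigr => i _; rewrite diracE.
  have -> : (nat_of_ord i \in [set j | (k <= j)%N]) = (k <= i)%N.
    by apply/idP/idP; rewrite inE.
  case: leqP => _; last by rewrite mule0.
  rewrite mule1; congr EFin.
  rewrite /unstable.onem (_ : 1 - 1 / 2 = 1 / 2); last by rewrite {1}(splitr 1) addrK.
  have iN : (i <= N)%N by rewrite -ltnS.
  by rewrite -exprD (subnKC iN) div1r exprVn mulr_natl.
by rewrite lee_fin ler_pdivrMr ?exprn_gt0.
Qed.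

(** * Joint law of the sampled labels *)

Section sampled_labels.
Context (R : realType) (d n : nat) (sigma : R) (x : d.-tuple (measurableTypeR R)).

Definition label_prob (L : finType) (F : d.-tuple (measurableTypeR R) -> L) (c : L) : R :=
  fine (gauss d sigma [set e | F (vadd x e) = c]).

Definition labels (L : finType) (F : d.-tuple (measurableTypeR R) -> L)
    (eps : 'I_n -> d.-tuple (measurableTypeR R)) : {ffun 'I_n -> L} :=
  [ffun i => F (vadd x (eps i))].

Lemma label_countsE (L : finType) (F : d.-tuple (measurableTypeR R) -> L) eps :
  label_counts F x eps = counts (labels F eps).
Proof.
apply/ffunP => c; rewrite !ffunE; congr #|pred_of_set _|.
by apply/setP => i; rewrite !inE ffunE.
Qed.

Lemma measurable_label (L : finType) (F : d.-tuple (measurableTypeR R) -> L) (c : L) :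
  classifier_measurable F -> measurable [set e | F (vadd x e) = c].
Proof.
move=> mF; rewrite -[X in measurable X]setTI.
exact: (measurable_vadd x measurableT (mF c)).
Qed.

Lemma label_probE (L : finType) (F : d.-tuple (measurableTypeR R) -> L) (c : L) :
  classifier_measurable F ->
  gauss d sigma [set e | F (vadd x e) = c] = (label_prob F c)%:E.
Proof. by move=> mF; rewrite fineK // fin_num_measure //; exact: measurable_label. Qed.

Lemma label_prob_ge0 (L : finType) (F : d.-tuple (measurableTypeR R) -> L) c :
  0 <= label_prob F c.
Proof. exact: fine_ge0. Qed.

Lemma sum_label_prob (L : finType) (F : d.-tuple (measurableTypeR R) -> L) :
  classifier_measurable F -> \sum_c label_prob F c = 1.
Proof.
move=> mF; apply: EFin_inj; rewrite -sumEFin.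
rewrite -(eq_bigr _ (fun c _ => label_probE c mF)).
rewrite -(@measure_finite_range _ _ _ (gauss d sigma) L
            (fun e => F (vadd x e)) predT) /=; last first.
  by move=> c; exact: measurable_label.
rewrite (_ : [set _ | _] = setT) ?probability_setT //.
by apply/seteqP; split.
Qed.

Lemma smoothed_argmax (L : finType) (am : {ffun L -> \bar R} -> L)
    (F : d.-tuple (measurableTypeR R) -> L) c :
  is_argmax am -> classifier_measurable F ->
  label_prob F c <= label_prob F (smoothed am sigma F x).
Proof.
move=> ham mF; rewrite -lee_fin -!label_probE //.
by have := ham [ffun c => gauss d sigma [set e | F (vadd x e) = c]] c; rewrite !ffunE.
Qed.

Context (dO : measure_display) (Omega : measurableType dO) (P : probability Omega R).
Context (L1 L2 : finType) (F1 : d.-tuple (measurableTypeR R) -> L1)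
  (F2 : d.-tuple (measurableTypeR R) -> L2)
  (mF1 : classifier_measurable F1) (mF2 : classifier_measurable F2).
Context (eps1 eps2 : 'I_n -> {RV P >-> d.-tuple (measurableTypeR R)})
    (law1 : forall i A, measurable A -> distribution P (eps1 i) A = gauss d sigma A)
    (law2 : forall i A, measurable A -> distribution P (eps2 i) A = gauss d sigma A)
    (indep : mutually_independent (sum_family eps1 eps2)).

Let U w := labels F1 (fun i => eps1 i w).
Let V w := labels F2 (fun i => eps2 i w).

(** The event splits into fibres of the pair of words. Each fibre constrains every noise vector
    separately, so joint independence factors its probability. *)
Lemma prob_labels (Q : pred ({ffun 'I_n -> L1} * {ffun 'I_n -> L2})) :
  P [set w | Q (U w, V w)] =
  (\sum_(z | Q z) word_weight (label_prob F1) z.1 *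
                  word_weight (label_prob F2) z.2)%:E.
Proof.
pose A (z : {ffun 'I_n -> L1} * {ffun 'I_n -> L2}) (k : 'I_n + 'I_n) := match k with
  | inl i => [set e | F1 (vadd x e) = z.1 i]
  | inr i => [set e | F2 (vadd x e) = z.2 i] end.
have mA z k : measurable (A z k) by case: k => i; exact: measurable_label.
have preE z : (fun w => (U w, V w)) @^-1` [set z] =
    [set w | forall k, k \in [set: 'I_n + 'I_n]%SET -> A z k (sum_family eps1 eps2 k w)].
  case: z => u v; apply/seteqP; split=> w /=.
    by move=> [<- <-] [i|i] _ /=; rewrite ffunE.
  move=> H; congr pair; apply/ffunP => i; rewrite ffunE.
    by apply: (H (inl i)); rewrite inE.
  by apply: (H (inr i)); rewrite inE.
rewrite (@measure_finite_range _ _ _ P _ (fun w => (U w, V w)) Q) /=; last first.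
  move=> z; rewrite preE (_ : mkset _ = \bigcap_(k in setT)
      (sum_family eps1 eps2 k @^-1` A z k)); last first.
    by apply/seteqP; split=> w /= H k; [move=> _; apply: H; rewrite inE|move=> _; exact: H].
  apply: fin_bigcap_measurable => // k _.
  by rewrite -[X in measurable X]setTI; exact: measurable_funPT.
rewrite -sumEFin; apply: eq_bigr => z _.
rewrite preE indep //= /word_weight (eq_bigl predT); last by move=> k; rewrite inE.
rewrite big_sumType /= EFinM -!prodEFin.
by congr (_ * _)%E; apply: eq_bigr => i _; rewrite -label_probE //;
   [rewrite -(law1 i) | rewrite -(law2 i)] => //; exact: measurable_label.
Qed.

End sampled_labels.

(** * Transfer to the algorithm *)

Lemma predictE (R : realType) (d m n : nat)
    (FSelect : d.-tuple (measurableTypeR R) -> bool)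
    (FCertify FCore : d.-tuple (measurableTypeR R) -> 'I_m)
    (top2 : {ffun 'I_m -> nat} -> 'I_m * 'I_m) x (alpha : R) epsS epsC :
  predict FSelect FCertify FCore top2 x alpha epsS epsC =
  decide (alpha / 2) n top2 (FCore x) (counts (labels (n := n) x FSelect epsS))
    (counts (labels x FCertify epsC)).
Proof.
rewrite /predict !label_countsE !binom_pvalue_le /decide /selected /verified.
set u := labels x FSelect epsS.
have := counts_bool u true; rewrite card_ord /= => un.
have -> : (n - counts u true = counts u false)%N by rewrite -[X in (X - _)%N]un addKn.
have -> : (n - counts u false = counts u true)%N by rewrite -[X in (X - _)%N]un addnK.
by rewrite andbA.
Qed.

Theorem theoremB2 (R : realType) (d m : nat)
    (FSelect : d.-tuple (measurableTypeR R) -> bool)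
    (FCertify FCore : d.-tuple (measurableTypeR R) -> 'I_m)
    (mSelect : classifier_measurable FSelect)
    (mCertify : classifier_measurable FCertify)
    (mCore : classifier_measurable FCore)
    (hm : (2 <= m)%N)
    (sigma : R) (hsigma : 0 < sigma)
    (alpha : R) (halpha : 0 < alpha < 1)
    (n : nat) (hn : (1 <= n)%N)
    (amS : {ffun bool -> \bar R} -> bool) (hamS : is_argmax amS)
    (amC : {ffun 'I_m -> \bar R} -> 'I_m) (hamC : is_argmax amC)
    (top2 : {ffun 'I_m -> nat} -> 'I_m * 'I_m) (htop2 : is_top2 top2)
    (x : d.-tuple (measurableTypeR R))
    (dO : measure_display) (Omega : measurableType dO) (P : probability Omega R)
    (epsS epsC : 'I_n -> {RV P >-> d.-tuple (measurableTypeR R)})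
    (lawS : forall i A, measurable A ->
      distribution P (epsS i) A = gauss d sigma A)
    (lawC : forall i A, measurable A ->
      distribution P (epsC i) A = gauss d sigma A)
    (indep : mutually_independent (sum_family epsS epsC)) :
  let chat w := predict FSelect FCertify FCore top2 x alpha
                  (fun i => epsS i w) (fun i => epsC i w) in
  ((1 - alpha)%:E <=
   P [set w | chat w = None \/
              chat w = Some (F_ACES FSelect FCertify FCore amS amC sigma x)])%E.
Proof.
cbv zeta; set target := F_ACES _ _ _ _ _ _ _; set good := mkset _.
pose bad (z : {ffun 'I_n -> bool} * {ffun 'I_n -> 'I_m}) :=
  decide (alpha / 2) n top2 (FCore x) (counts z.1) (counts z.2)
    \notin [:: None; Some target].
have -> : good =
    [set w | ~~ bad (labels x FSelect (fun i => epsS i w),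
                     labels x FCertify (fun i => epsC i w))].
  apply/seteqP; split=> w; rewrite /good /= predictE /bad /= negbK !inE.
    by case=> ->; rewrite eqxx ?orbT.
  by move/orP => [] /eqP ->; [left|right].
rewrite (prob_labels x mSelect mCertify lawS lawC indep (predC bad)) lee_fin /=.
set pS := label_prob sigma x FSelect; set pC := label_prob sigma x FCertify.
have sS := sum_label_prob sigma x mSelect; have sC := sum_label_prob sigma x mCertify.
have total : \sum_(z : {ffun 'I_n -> bool} * {ffun 'I_n -> 'I_m})
    word_weight pS z.1 * word_weight pC z.2 = 1.
  rewrite -(pair_bigA _ (fun u v => word_weight pS u * word_weight pC v)) /=.
  by rewrite -big_distrlr /= !sum_word_weight // mul1r.
(* As the weights sum to 1, it remains to bound the weight of the bad pairs by [alpha]. *)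
rewrite -total (bigID bad) /= lerBlDr addrC lerD2l.
rewrite big_mkcond /= -(pair_bigA _ (fun u v => if bad (u, v)
  then word_weight pS u * word_weight pC v else 0)) /=.
have -> : alpha = 2 * (alpha / 2) by rewrite mulrC divfK // pnatr_eq0.
have [a0 a1] := andP halpha.
(* [alpha < 1] yields the strict bound on [h] behind [verified_wrong_winner_le]. *)
have h2 : 0 <= alpha / 2 < 2^-1.
  by rewrite divr_ge0 ?(ltW a0) //= ltr_pdivrMr ?mulVf ?pnatr_eq0.
have := @decide_error R (alpha / 2) m n top2 (FCore x) pS pC
  (smoothed amS sigma FSelect x) (smoothed amC sigma FCertify x) htop2 h2
  (label_prob_ge0 sigma x FSelect) sS (smoothed_argmax sigma x _ hamS mSelect)
  (label_prob_ge0 sigma x FCertify) sC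
  (fun l => smoothed_argmax sigma x l hamC mCertify).
apply: le_trans; apply: ler_sum => u _; apply: ler_sum => v _.
rewrite /bad /target /F_ACES /=.
by case: ifP => _; rewrite ?mul1r ?mul0r.
Qed.
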